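(* Let $(S,g)$ be a Damek--Ricci space and let $\xi$ be a (smooth) conformal vector field on $(S,g)$, i.e. $\mathcal{L}_\xi g = 2\rho g$ for some smooth function $\rho$ on $S$. Then the potential function $\rho$ vanishes identically; that is, $\xi$ is a Killing vector field.
   Context: A generalized Heisenberg algebra is a two-step nilpotent real Lie algebra $\mathfrak{n}=\mathfrak{v}\oplus\mathfrak{z}$ with an inner product $\langle\cdot,\cdot\rangle$, where $\mathfrak{z}$ is the center, $\mathfrak{v}$ is its orthogonal complement, $[\mathfrak{v},\mathfrak{v}]\subset\mathfrak{z}$, $[\mathfrak{v},\mathfrak{z}]=0$, and the maps $J_Z:\mathfrak{v}\to\mathfrak{v}$ ($Z\in\mathfrak{z}$) defined by $\langle J_ZV,W\rangle=\langle Z,[V,W]\rangle$ satisfy $J_Z^2=-\|Z\|^2\,\mathrm{Id}_{\mathfrak{v}}$ for all $Z\in\mathfrak{z}$. Given such $\mathfrak{n}$, let $\mathfrak{s}=\mathfrak{v}\oplus\mathfrak{z}\oplus\mathfrak{a}$ with $\mathfrak{a}=\mathbb{R}A$ and brackets extended by $[A,V]=\tfrac12 V$, $[A,Z]=Z$ for $V\in\mathfrak{v}$, $Z\in\mathfrak{z}$; equip $\mathfrak{s}$ with the inner product making $\mathfrak{v},\mathfrak{z},\mathfrak{a}$ mutually orthogonal, restricting to the given one on $\mathfrak{n}$, and with $\|A\|=1$. The Damek--Ricci space $S$ is the simply connected Lie group with Lie algebra $\mathfrak{s}$ endowed with the induced left-invariant Riemannian metric $g$. A smooth vector field $\xi$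 is conformal if $\mathcal{L}_\xi g=2\rho g$ for a smooth function $\rho$ (its potential function); it is Killing if $\rho\equiv0$. *)

(* Defs.v *)
From HB Require Import structures.
From mathcomp Require Import all_boot all_order all_algebra.
From mathcomp Require Import all_classical all_reals all_analysis.
Set Implicit Arguments. Unset Strict Implicit. Unset Printing Implicit Defensive.
Import Order.TTheory GRing.Theory Num.Theory.
Import numFieldNormedType.Exports.
Local Open Scope ring_scope.

Definition dotv (R : realType) (k : nat) (u w : 'rV[R]_k) : R := (u *m w^T) 0 0.

(* Generalized Heisenberg algebra n = v (+) z, with v = R^n, z = R^m (with their
   standard inner products, i.e. after choosing orthonormal bases).  The bracket on
   n is determined by br : v x v -> z ([v,z] = 0, z central). *)
(* J_Z as an n x n matrix acting on row vectors: <V *m J Z, W> = <Z, br V W>. *)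
Definition Jmap (R : realType) (n m : nat) (br : 'rV[R]_n -> 'rV[R]_n -> 'rV[R]_m)
  (Z : 'rV[R]_m) : 'M[R]_n :=
  \matrix_(i < n, j < n) dotv Z (br (delta_mx 0 i) (delta_mx 0 j)).

Definition is_gen_heisenberg (R : realType) (n m : nat)
  (br : 'rV[R]_n -> 'rV[R]_n -> 'rV[R]_m) : Prop :=
  [/\
      (forall (a : R) (u v w : 'rV[R]_n), br (a *: u + v) w = a *: br u w + br v w),
      (forall (a : R) (u v w : 'rV[R]_n), br w (a *: u + v) = a *: br w u + br w v),
      (forall u v : 'rV[R]_n, br u v = - br v u),
      (* the center of n = v (+) z is exactly z: no nonzero V in v is central *)
      (forall V : 'rV[R]_n, (forall W, br V W = 0) -> V = 0) &
      (forall Z : 'rV[R]_m, Jmap br Z *m Jmap br Z = - (dotv Z Z) *: 1%:M)].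

(* Points of the Damek--Ricci group S, in the global coordinates
   (V, Z, t) <-> (exp(V + Z)) * exp(t A) identifying S with v x z x R. *)
Definition DR (R : realType) (n m : nat) := ('rV[R]_n * 'rV[R]_m * R)%type.

(* Group law of S = N x| R, with N = (v x z, (V,Z)(V',Z') = (V+V', Z+Z'+1/2[V,V']))
   and R acting on N by (V,Z) |-> (e^{t/2} V, e^t Z) (i.e. exp of ad A). *)
Definition DRmul (R : realType) (n m : nat) (br : 'rV[R]_n -> 'rV[R]_n -> 'rV[R]_m)
  (p q : DR R n m) : DR R n m :=
  let: (V, Z, t) := p in let: (V', Z', t') := q in
  (V + expR (t / 2) *: V',
   Z + expR t *: Z' + (2^-1 * expR (t / 2)) *: br V V',
   t + t').

Definition DRinv (R : realType) (n m : nat) (p : DR R n m) : DR R n m :=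
  let: (V, Z, t) := p in (- (expR (- t / 2) *: V), - (expR (- t) *: Z), - t).

(* Inner product on s = v (+) z (+) R A (identified with the tangent space at the
   identity (0,0,0) via the coordinates): v, z, a orthogonal, |A| = 1. *)
Definition sinner (R : realType) (n m : nat) (X Y : DR R n m) : R :=
  dotv X.1.1 Y.1.1 + dotv X.1.2 Y.1.2 + X.2 * Y.2.

Definition DRmetric (R : realType) (n m : nat) (br : 'rV[R]_n -> 'rV[R]_n -> 'rV[R]_m)
  (p X Y : DR R n m) : R :=
  sinner ('d (DRmul br (DRinv p)) p X) ('d (DRmul br (DRinv p)) p Y).

Fixpoint iter_derive (R : realType) (U W : normedModType R) (vs : seq U) (f : U -> W)
  : U -> W :=
  match vs with
  | [::] => f
  | v :: vs' => fun x => 'D_v (iter_derive vs' f) x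
  end.

Definition smooth (R : realType) (U W : normedModType R) (f : U -> W) : Prop :=
  forall (vs : seq U) (x : U), differentiable (iter_derive vs f) x.

(* Lie derivative of the metric g along the vector field xi, evaluated on the
   (constant) coordinate vector fields X, Y:
   (L_xi g)(X,Y) = xi(g(X,Y)) - g([xi,X],Y) - g(X,[xi,Y]),  with [xi,X] = - dxi(X). *)
Definition lie_deriv_metric (R : realType) (n m : nat)
  (g : DR R n m -> DR R n m -> DR R n m -> R) (xi : DR R n m -> DR R n m)
  (p X Y : DR R n m) : R :=
  'd (fun q => g q X Y) p (xi p) + g p ('d xi p X) Y + g p X ('d xi p Y).

Definition conformal_with_potential (R : realType) (n m : nat)
  (g : DR R n m -> DR R n m -> DR R n m -> R) (xi : DR R n m -> DR R n m)
  (rho : DR R n m -> R) : Prop :=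
  smooth xi /\ smooth rho /\
  forall p X Y : DR R n m, lie_deriv_metric g xi p X Y = 2 * rho p * g p X Y.

(* Main.v *)
Require Import Defs.
From HB Require Import structures.
From mathcomp Require Import all_boot all_order all_algebra.
From mathcomp Require Import all_classical all_reals all_analysis.
From mathcomp Require Import ring lra.
Set Implicit Arguments. Unset Strict Implicit. Unset Printing Implicit Defensive.
Import Order.TTheory GRing.Theory Num.Theory.
Import numFieldNormedType.Exports.
Local Open Scope ring_scope.

(* In a left-invariant frame, the conformal equation is a linear first-order
   system for the components of xi. Fix unit vectors V in v and Z in z and put
   W := J_Z V. Then A, V, W, Z span the Lie algebra of a complex hyperbolic
   plane, which is totally geodesic, so the components of xi along these four
   directions satisfy a closed system, with the same potential rho. On this
   plane |Weyl|^2 is a nonzero constant, while a conformal field satisfies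
   xi(|Weyl|^2) = -4 rho |Weyl|^2, whence rho = 0. Concretely, a constant
   coefficient combination of the equations and of their second derivatives
   along the frame reduces to rho = 0, using only the commutation relations of
   the frame. *)

(** * Closure properties of smooth functions *)

Section SmoothFunctions.
Context {R : realType} {U : normedModType R}.
Implicit Types f g : U -> R.

Lemma iter_derive_rcons (W : normedModType R) (vs : seq U) v (f : U -> W) :
  iter_derive (rcons vs v) f = iter_derive vs (fun x => 'D_v f x).
Proof. by elim: vs => //= w vs ->. Qed.

Lemma smooth_differentiable (W : normedModType R) (f : U -> W) x :
  smooth f -> differentiable f x.
Proof. by move=> /(_ [::] x). Qed.

Lemma smooth_derive (W : normedModType R) (f : U -> W) v :
  smooth f -> smooth (fun x => 'D_v f x).
Proof. by move=> sf vs x; rewrite -iter_derive_rcons. Qed.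

(** Smoothness graded by order, so that closure under sums and products goes by induction on [k].
    The recursion peels off the derivative that is taken first, which is the last entry of the list
    in [iter_derive]. *)
Fixpoint times_differentiable (k : nat) f : Prop :=
  (forall x, differentiable f x) /\
  if k is k'.+1 then forall v, times_differentiable k' (fun x => 'D_v f x)
  else True.

Lemma times_differentiable_diff k f x :
  times_differentiable k f -> differentiable f x.
Proof. by case: k => [|k] []. Qed.

Lemma smoothP f : smooth f <-> forall k, times_differentiable k f.
Proof.
split=> [sf k|sf vs x].
  elim: k f sf => [|k IHk] f sf; split; [move=> x| |move=> x|].
  - exact: smooth_differentiable.
  - by [].
  - exact: smooth_differentiable.
  - by move=> v; apply/IHk/smooth_derive.
elim/last_ind: vs f sf x => [|vs v IHvs] f sf x; first exact: (sf 0%N).1.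
by rewrite iter_derive_rcons; apply: IHvs => k; exact: (sf k.+1).2.
Qed.

Lemma times_differentiableW k f :
  times_differentiable k.+1 f -> times_differentiable k f.
Proof. by elim: k f => [|k IHk] f [? df]; split=> // v; apply/IHk/df. Qed.

Lemma times_differentiableD k f g : times_differentiable k f ->
  times_differentiable k g -> times_differentiable k (fun x => f x + g x).
Proof.
elim: k f g => [|k IHk] f g [df Df] [dg Dg]; split; [move=> x| |move=> x|move=> v] => //;
  do ?exact: differentiableD.
 rewrite (_ : (fun x => _) = (fun x => 'D_v f x + 'D_v g x)).
  exact: IHk (Df v) (Dg v).
by apply/funext => x; rewrite deriveD//; exact: diff_derivable.
Qed.

(** By the Leibniz rule the derivative is a sum of products in which one factor has been
    differentiated; the other factor is lowered to the same order by [times_differentiableW]. *)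
Lemma times_differentiableM k f g : times_differentiable k f ->
  times_differentiable k g -> times_differentiable k (fun x => f x * g x).
Proof.
elim: k f g => [|k IHk] f g kf kg;
  split; [move=> x| |move=> x|move=> v] => //; do ?[by apply: differentiableM;
    apply: times_differentiable_diff; eassumption].
rewrite (_ : (fun x => _) = (fun x => f x * 'D_v g x + g x * 'D_v f x)).
  have [_ Df] := kf; have [_ Dg] := kg.
  apply: times_differentiableD; first exact: IHk (times_differentiableW kf) (Dg v).
  exact: IHk (times_differentiableW kg) (Df v).
apply/funext => x; rewrite deriveM//; apply: diff_derivable;
  apply: times_differentiable_diff; eassumption.
Qed.

Lemma smoothD f g : smooth f -> smooth g -> smooth (fun x => f x + g x).
Proof. by rewrite !smoothP => sf sg k; apply: times_differentiableD. Qed.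

Lemma smoothM f g : smooth f -> smooth g -> smooth (fun x => f x * g x).
Proof. by rewrite !smoothP => sf sg k; apply: times_differentiableM. Qed.

Lemma smooth_cst (c : R) : smooth (fun _ : U => c).
Proof.
apply/smoothP => k; elim: k c => [|k IHk] c; split=> //.
move=> v; have -> : (fun x => 'D_v (fun _ : U => c) x) = (fun=> 0).
  by apply/funext => x; exact: derive_cst.
exact: IHk.
Qed.

Lemma smooth_sum (I : Type) (r : seq I) (F : I -> U -> R) :
  (forall i, smooth (F i)) -> smooth (fun x => \sum_(i <- r) F i x).
Proof.
move=> sF; elim: r => [|i r IHr].
  by under eq_fun do rewrite big_nil; exact: smooth_cst.
by under eq_fun do rewrite big_cons; apply: smoothD.
Qed.

(* Differentiating exp o f only multiplies it by the smooth function f'. *)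
Lemma smooth_expR f : smooth f -> smooth (fun x => expR (f x)).
Proof.
move=> sf; have de x : differentiable (fun x => expR (f x)) x.
  apply: (@differentiable_comp _ _ _ _ f expR); first exact: smooth_differentiable.
  exact/derivable1_diffP/derivable_expR.
apply/smoothP; elim=> [|k IHk]; split=> // v.
rewrite (_ : (fun x => _) = (fun x => expR (f x) * 'D_v f x)).
  by apply: times_differentiableM => //; have /smoothP := smooth_derive v sf; apply.
apply/funext => x; have dfx := smooth_differentiable x sf.
rewrite [LHS]deriveE// deriveE//.
have dE : differentiable expR (f x) by exact/derivable1_diffP/derivable_expR.
rewrite (@diff_comp _ _ _ _ f expR)//= diff1E//.
by rewrite derive1E derive_val mulrC.
Qed.

(** A continuous linear map commutes with directional derivatives, so every iterated derivative of
    the composite is the image under [l] of one of [f]. *)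
Lemma smooth_linear (W V : normedModType R) (l : {linear W -> V}) (f : U -> W) :
  continuous l -> smooth f -> smooth (fun x => l (f x)).
Proof.
move=> cl sf vs.
have -> : iter_derive vs (fun x => l (f x)) = l \o iter_derive vs f.
  elim: vs => //= v vs ->; apply/funext => x /=.
  have dl : differentiable l (iter_derive vs f x) by exact: linear_differentiable.
  rewrite deriveE; last by apply: differentiable_comp.
  by rewrite diff_comp//= diff_lin// deriveE.
by move=> x; apply: differentiable_comp => //; exact: linear_differentiable.
Qed.

End SmoothFunctions.

(** * Symmetry of second derivatives *)

Section MixedDerivatives.
Context {R : realType} {U : normedModType R}.
Local Open Scope classical_set_scope.
Implicit Types f g : U -> R.

Lemma is_derive_line f (p u : U) (s : R) : (forall x, differentiable f x) ->
  is_derive s 1 (fun s => f (p + s *: u)) ('D_u f (p + s *: u)).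
Proof.
move=> df.
have dl : is_diff s (fun s : R => p + s *: u) (fun s => s *: u).
  have -> : (fun s : R => p + s *: u) = cst p + ( *:%R^~ u) by [].
  by apply: is_diff_eq; rewrite add0r.
have dc : differentiable (fun s : R => f (p + s *: u)) s.
  by apply: (@differentiable_comp _ _ _ _ (fun s : R => p + s *: u) f).
apply: DeriveDef; first exact: diff_derivable.
rewrite deriveE// deriveE//.
rewrite (@diff_comp _ _ _ _ (fun s : R => p + s *: u) f)//=.
by rewrite diff_val scale1r.
Qed.

Lemma MVT_line f (p u : U) (h : R) : 0 < h -> (forall x, differentiable f x) ->
  exists2 c, 0 < c < h & f (p + h *: u) - f p = 'D_u f (p + c *: u) * h.
Proof.
move=> h0 df.
have [] := @MVT R (fun s => f (p + s *: u)) (fun s => 'D_u f (p + s *: u)) 0 h h0.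
- by move=> x _; exact: is_derive_line.
- apply: continuous_subspaceT => x.
  have [dx _] := is_derive_line p u x df.
  exact/differentiable_continuous/derivable1_diffP.
- move=> c; rewrite in_itv/= => ch.
  by rewrite scale0r addr0 subr0 => E; exists c.
Qed.

(* Two applications of the mean value theorem, first along u, then along w. *)
Lemma MVT_rectangle f (p u w : U) (h : R) : 0 < h -> smooth f ->
  exists c d, [/\ 0 < c < h, 0 < d < h &
    f (p + h *: u + h *: w) - f (p + h *: u) - f (p + h *: w) + f p =
    'D_w (fun x => 'D_u f x) (p + c *: u + d *: w) * h * h].
Proof.
move=> h0 sf; have df x := smooth_differentiable x sf.
(* The mixed second difference over the rectangle is the increment of [g] along [u]. *)
pose g x := f (x + h *: w) - f x.
have dsh x : differentiable (fun x => f (x + h *: w)) x.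
  apply: (@differentiable_comp _ _ _ _ (fun x => x + h *: w) f); last exact: df.
  have -> : (fun x : U => x + h *: w) = id + cst (h *: w) by [].
  exact: differentiableD.
have dg x : differentiable g x by apply: differentiableB.
have [c ch gE] := MVT_line p u h0 dg.
have [d dh fE] := MVT_line (p + c *: u) w h0
  (fun x => smooth_differentiable x (smooth_derive u sf)).
exists c, d; split=> //; rewrite -fE.
transitivity (g (p + h *: u) - g p); first by rewrite /g; ring.
rewrite gE; congr (_ * _); rewrite deriveB; last 2 first.
- exact: diff_derivable.
- exact: diff_derivable.
(* The derivative of a translate is the translate of the derivative: the difference quotients agree
   once the sums are reordered. *)
congr (_ - _); rewrite /derive.
apply: (congr1 (fun F : R -> R => lim (F @ 0^'))).
by apply/funext => k /=; rewrite -!addrA.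
Qed.

(** Controls the intermediate points of [MVT_rectangle]. Uniformity in [h' <= h] lets two such
    bounds be used at a common size. *)
Lemma near_rectangle g (p u w : U) (e : R) : 0 < e -> {for p, continuous g} ->
  exists2 h, 0 < h & forall c d h', h' <= h -> 0 < c < h' -> 0 < d < h' ->
    `|g p - g (p + c *: u + d *: w)| < e.
Proof.
move=> e0 cg; have := @cvgrPdist_lt _ _ _ _ _ g (g p).
move=> /(_ (nbhs p) _)[+ _] => /(_ cg e e0)/nbhs_ballP[r /= r0 br].
(* [k] bounds the displacement per unit of [h']; the added 1 keeps it positive when [u] and [w] both
   vanish. *)
pose k := `|u| + `|w| + 1.
have k0 : 0 < k by rewrite ltr_wpDl// addr_ge0.
exists (r / k); first exact: divr_gt0.
move=> c d h' hh /andP[c0 ch] /andP[d0 dh]; apply: br.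
rewrite -ball_normE/= opprD addrA opprD addrA subrr add0r -opprD normrN.
apply: le_lt_trans (ler_normD _ _) _; rewrite !normrZ !gtr0_norm//.
have hr : h' * k <= r by rewrite -ler_pdivlMr.
apply: lt_le_trans hr; rewrite /k.
have := normr_ge0 u; have := normr_ge0 w; nra.
Qed.

(** Schwarz's theorem. The second difference over a small square is symmetric in [u] and [w], so one
    mixed derivative at a point near [p] equals the other at another such point; continuity of both
    does the rest. *)
Lemma derive_comm f (p u w : U) : smooth f ->
  'D_u (fun x => 'D_w f x) p = 'D_w (fun x => 'D_u f x) p.
Proof.
move=> sf; apply/eqP; rewrite -subr_eq0 -normr_le0; apply/ler_addgt0Pr => e e0; rewrite add0r.
have e20 : 0 < e / 2 by lra.
have close (a b c : R) : `|a - c| < e / 2 -> `|b - c| < e / 2 -> `|a - b| <= e.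
  by rewrite !ltr_norml ler_norml => /andP[? ?] /andP[? ?]; lra.
have cont v v' : {for p, continuous (fun x => 'D_v (fun x => 'D_v' f x) x)}.
  exact/differentiable_continuous/smooth_differentiable/smooth_derive/smooth_derive.
have [h h0 nh] := near_rectangle w u e20 (cont u w).
have [k k0 nk] := near_rectangle u w e20 (cont w u).
pose l := Num.min h k; have l0 : 0 < l by rewrite lt_min h0.
have [c [d [cl dl E]]] := MVT_rectangle p u w l0 sf.
have [c' [d' [cl' dl' E']]] := MVT_rectangle p w u l0 sf.
have lh : l <= h by rewrite ge_min lexx.
have lk : l <= k by rewrite ge_min lexx orbT.
move: {nh} (nh _ _ _ lh cl' dl') (nk _ _ _ lk cl dl).
(* Multiplied by [l] twice, both sides are the same second difference. *)
have -> : 'D_u (fun x => 'D_w f x) (p + c' *: w + d' *: u) =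
          'D_w (fun x => 'D_u f x) (p + c *: u + d *: w).
  apply: (mulIf (lt0r_neq0 l0)); apply: (mulIf (lt0r_neq0 l0)).
  apply: etrans (esym E') (etrans _ E).
  by rewrite (addrAC p (l *: w)); congr (_ + _); exact: addrAC.
exact: close.
Qed.

End MixedDerivatives.

(** * Vector fields as derivations, and their commutators *)

Section SmoothFields.
Context {R : realType} {U : normedModType R}.
Implicit Types (f g : U -> R) (X Y : U -> U).

Definition lie_derive X f : U -> R := fun q => 'd f q (X q).

(** Regularity is recorded through the action on functions, together with the Leibniz formula for
    the differential of that action. This is what the commutator formula consumes, and it passes to
    sums and to function multiples of constant fields. *)
Definition smooth_field X := (forall p, differentiable X p) /\
  forall f, smooth f -> smooth (lie_derive X f) /\
    forall p v, 'd (lie_derive X f) p v =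
      'D_v (fun q => 'D_(X p) f q) p + 'd f p ('d X p v).

Lemma smooth_lie_derive X f :
  smooth_field X -> smooth f -> smooth (lie_derive X f).
Proof. by case=> _ H /H[]. Qed.

Lemma smooth_fieldZ (c : U -> R) (b : U) :
  smooth c -> smooth_field (fun q => c q *: b).
Proof.
move=> sc; have dc p := smooth_differentiable p sc.
split=> [p|f sf]; first exact: differentiableZl.
have lE : lie_derive (fun q => c q *: b) f = (fun q => c q * 'D_b f q).
  apply/funext => q; rewrite /lie_derive linearZ/= deriveE//.
  exact: smooth_differentiable.
rewrite lE; split; first by apply: smoothM => //; exact: smooth_derive.
move=> p v; have sDf := smooth_derive b sf.
rewrite (diffM (dc p) (smooth_differentiable p sDf)) diffZl//=.
congr (_ + _); last first.
  by rewrite deriveE ?linearZ/=; [exact: mulrC|exact: smooth_differentiable].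
(* The direction is frozen at [p], so the coefficient [c p] is a constant. *)
have -> : (fun q => 'D_(c p *: b) f q) = c p *: (fun q => 'D_b f q).
  apply/funext => q; rewrite [LHS]deriveE; last exact: smooth_differentiable.
  by rewrite linearZ/= -deriveE//; exact: smooth_differentiable.
rewrite deriveE; last by apply: differentiableZ; exact: smooth_differentiable.
exact: (congr1 (@^~ v) (esym (diffZ (c p) (smooth_differentiable p sDf)))).
Qed.

Lemma smooth_fieldD X Y :
  smooth_field X -> smooth_field Y -> smooth_field (fun q => X q + Y q).
Proof.
move=> [dX sX] [dY sY]; split=> [p|f sf]; first exact: differentiableD.
have [sXf dXf] := sX f sf; have [sYf dYf] := sY f sf.
have lE : lie_derive (fun q => X q + Y q) f =
          (fun q => lie_derive X f q + lie_derive Y f q).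
  by apply/funext => q; rewrite /lie_derive linearD.
rewrite lE; split; first exact: smoothD.
move=> p v; rewrite (diffD (smooth_differentiable p sXf) (smooth_differentiable p sYf))/=.
have -> : 'd (fun q => X q + Y q) p v = 'd X p v + 'd Y p v.
  exact: (congr1 (@^~ v) (diffD (dX p) (dY p))).
apply: etrans (congr2 +%R (dXf p v) (dYf p v)) _.
rewrite addrACA (linearD ('d f p) ('d X p v) ('d Y p v)); congr (_ + _).
rewrite -deriveD; last 2 first.
- by apply: diff_derivable; apply/smooth_differentiable/smooth_derive.
- by apply: diff_derivable; apply/smooth_differentiable/smooth_derive.
congr ('D_v _ p); apply/funext => q /=; have df := smooth_differentiable q sf.
by rewrite (deriveE (X p + Y p) df) linearD -(deriveE _ df) -(deriveE _ df).
Qed.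

Lemma smooth_field_cst (b : U) : smooth_field (fun=> b).
Proof.
have -> : (fun _ : U => b) = (fun q => (cst 1 : U -> R) q *: b).
  by apply/funext => q; rewrite scale1r.
exact/smooth_fieldZ/smooth_cst.
Qed.

Lemma smooth_field_sum (I : Type) (r : seq I) (F : I -> U -> U) :
  (forall i, smooth_field (F i)) -> smooth_field (fun q => \sum_(i <- r) F i q).
Proof.
move=> sF; elim: r => [|i r IHr].
  by under eq_fun do rewrite big_nil; exact: smooth_field_cst.
by under eq_fun do rewrite big_cons; apply: smooth_fieldD.
Qed.

(** The second-order terms on the two sides of the difference cancel by [derive_comm], leaving the
    first-order ones. *)
Lemma lie_derive_commutator X Y f p :
  smooth_field X -> smooth_field Y -> smooth f ->
  lie_derive X (lie_derive Y f) p - lie_derive Y (lie_derive X f) p =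
  'd f p ('d Y p (X p) - 'd X p (Y p)).
Proof.
move=> [_ sX] [_ sY] sf.
have [_ dXf] := sX f sf; have [_ dYf] := sY f sf.
rewrite {1}/lie_derive dYf {1}/lie_derive dXf linearB/= derive_comm//.
by rewrite opprD addrACA subrr add0r.
Qed.

Lemma lie_deriveD X f g : smooth f -> smooth g ->
  lie_derive X (fun q => f q + g q) =
  (fun q => lie_derive X f q + lie_derive X g q).
Proof.
move=> sf sg; apply/funext => q; rewrite /lie_derive.
by rewrite (diffD (smooth_differentiable q sf) (smooth_differentiable q sg)).
Qed.

Lemma lie_deriveZ X f (k : R) : smooth f ->
  lie_derive X (fun q => k * f q) = (fun q => k * lie_derive X f q).
Proof.
move=> sf; apply/funext => q; rewrite /lie_derive.
by rewrite (diffZ k (smooth_differentiable q sf)).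
Qed.

End SmoothFields.

(** * Product rules for bilinear maps *)

Section Bilinear.
Context {R : realType} {U : normedModType R}.

Lemma is_diff_bilinear (V1 V2 W : normedModType R)
    (B : {bilinear V1 -> V2 -> W}) (f df : U -> V1) (g dg : U -> V2) p :
  continuous (fun q => B q.1 q.2) -> is_diff p f df -> is_diff p g dg ->
  is_diff p (fun q => B (f q) (g q)) (fun v => B (df v) (g p) + B (f p) (dg v)).
Proof.
move=> cB dfp dgp.
have -> : (fun q => B (f q) (g q)) = (fun q => B q.1 q.2) \o (fun q => (f q, g q)) by [].
have dB : is_diff (f p, g p) (fun q => B q.1 q.2)
    (fun q => B (f p) q.2 + B q.1 (g p)).
  by apply: DiffDef; [exact: differentiable_bilin|rewrite diff_bilin].
by apply: is_diff_eq; apply/funext => v /=; rewrite addrC.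
Qed.

Lemma is_diff_scale (W : normedModType R) (k dk : U -> R) (g dg : U -> W) p :
  is_diff p k dk -> is_diff p g dg ->
  is_diff p (fun q => k q *: g q) (fun v => dk v *: g p + k p *: dg v).
Proof.
(* With scalars viewed as the module [R^o], scaling is bilinear and the product rule becomes an
   instance of [is_diff_bilinear]. *)
have scale_bilin : bilinear_for
    (GRing.Scale.Law.clone _ _ *:%R _) (GRing.Scale.Law.clone _ _ *:%R _)
    (fun (a : R^o) (w : W) => a *: w).
  split=> [w|a] b x y /=; first by rewrite scalerDl scalerA.
  by rewrite scalerDr !scalerA mulrC.
pose BM := bilinear_isBilinear.Build R R^o W W _ _ _ scale_bilin.
pose B : {bilinear R^o -> W -> W} := HB.pack (fun (a : R^o) (w : W) => a *: w) BM.
move=> dkp dgp.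
by apply: (@is_diff_bilinear _ _ _ B k dk g dg p) => // q; exact: scale_continuous.
Qed.

(** In finite dimension, expansion over the standard bases gives a finite sum of products of
    coordinates with constant vectors. *)
Lemma rV_bilinear_continuous (a b : nat) (W : normedModType R)
    (B : {bilinear 'rV[R]_a -> 'rV[R]_b -> W}) :
  continuous (fun q => B q.1 q.2).
Proof.
have -> : (fun q => B q.1 q.2) = (\sum_(i < a) \sum_(j < b)
    (fun q : 'rV[R]_a * 'rV[R]_b =>
      (q.1 0 i * q.2 0 j) *: B (delta_mx 0 i) (delta_mx 0 j))).
  apply/funext => -[u w] /=; rewrite fct_sumE {1}(row_sum_delta u) linear_sumlz.
  apply: eq_bigr => i _; rewrite linearZl_LR fct_sumE {1}(row_sum_delta w) linear_sumr.
  rewrite scaler_sumr.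
  by apply: eq_bigr => j _; rewrite linearZ_LR/= scalerA.
move=> q; apply: differentiable_continuous.
apply: differentiable_sum => i; apply: differentiable_sum => j.
apply: differentiableZl; apply: differentiableM.
  apply: (@differentiable_comp _ _ _ _ fst (fun u : 'rV[R]_a => u 0 i)).
    by apply: linear_differentiable => x; exact: cvg_fst.
  exact: differentiable_coord.
apply: (@differentiable_comp _ _ _ _ snd (fun u : 'rV[R]_b => u 0 j)).
  by apply: linear_differentiable => x; exact: cvg_snd.
exact: differentiable_coord.
Qed.

End Bilinear.

(** * The inner product and the coordinate forms on row vectors *)

Section DotProduct.
Context {R : realType} {k : nat}.

Lemma dotvE (u w : 'rV[R]_k) : dotv u w = \sum_i u 0 i * w 0 i.
Proof. by rewrite /dotv mxE; apply: eq_bigr => i _; rewrite mxE. Qed.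

Lemma dotvC (u w : 'rV[R]_k) : dotv u w = dotv w u.
Proof. by rewrite !dotvE; apply: eq_bigr => i _; rewrite mulrC. Qed.

Lemma dotv_is_bilinear : bilinear_for
    (GRing.Scale.Law.clone _ _ *:%R _) (GRing.Scale.Law.clone _ _ *:%R _)
    (@dotv R k).
Proof.
split=> [w|u] a x y; rewrite /dotv.
  by rewrite mulmxDl -scalemxAl !mxE.
by rewrite linearP/= mulmxDr -scalemxAr !mxE.
Qed.
HB.instance Definition _ := bilinear_isBilinear.Build R _ _ R _ _ (@dotv R k)
  dotv_is_bilinear.

Lemma dotvZl (a : R) (u w : 'rV[R]_k) : dotv (a *: u) w = a * dotv u w.
Proof. exact: linearZl_LR. Qed.

Lemma dotvNl (u w : 'rV[R]_k) : dotv (- u) w = - dotv u w.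
Proof. exact: linearNl. Qed.

Definition rv_coord (i : 'I_k) (u : 'rV[R]_k) : R := u 0 i.

Lemma rv_coord_is_linear i : linear (rv_coord i).
Proof. by move=> a u w; rewrite /rv_coord !mxE. Qed.
HB.instance Definition _ i :=
  GRing.isLinear.Build R _ R _ (rv_coord i) (rv_coord_is_linear i).

Lemma rv_coord_continuous i : continuous (rv_coord i).
Proof. by move=> u; exact: coord_continuous. Qed.

End DotProduct.

(** * Smoothness of continuous linear forms *)

Section LinearSmooth.
Context {R : realType} {U : normedModType R}.

Lemma smooth_linear_form (l : {linear U -> R}) : continuous l -> smooth l.
Proof.
move=> cl; apply/smoothP => -[|k]; split=> //; do ?[move=> x; exact: linear_differentiable].
move=> v; have -> : (fun x => 'D_v l x) = (fun=> l v).
  apply/funext => x; rewrite deriveE; last exact: linear_differentiable.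
  by rewrite diff_lin.
by have /smoothP := @smooth_cst R U (l v); apply.
Qed.

End LinearSmooth.

(** * The left-invariant frame, its inverse, and the Lie bracket *)

Section Frame.
Context {R : realType} {n m : nat}.
Variable br : {bilinear 'rV[R]_n -> 'rV[R]_n -> 'rV[R]_m}.
Local Notation S := (DR R n m).
Implicit Types (p q X Y u v w : S).

(* [frame p] is the differential at the identity of left translation by [p]
   (in coordinates), and [coframe p] is its inverse. *)
Definition frame p u : S :=
  (expR (p.2 * 2^-1) *: u.1.1,
   expR (p.2 * 1) *: u.1.2 + (2^-1 * expR (p.2 * 2^-1)) *: br p.1.1 u.1.1,
   u.2).

Definition coframe p X : S :=
  (expR (p.2 * - 2^-1) *: X.1.1,
   expR (p.2 * - 1) *: (X.1.2 - 2^-1 *: br p.1.1 X.1.1),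
   X.2).

(** The bracket of the solvable algebra s: ad A acts by 1/2 on v and by 1 on z, and [br] is the
    bracket of the Heisenberg part. *)
Definition lie u w : S :=
  (2^-1 *: (u.2 *: w.1.1 - w.2 *: u.1.1),
   u.2 *: w.1.2 - w.2 *: u.1.2 + br u.1.1 w.1.1,
   0).

Lemma expR_cancel (a b t : R) : a + b = 0 -> expR (t * a) * expR (t * b) = 1.
Proof. by move=> ab; rewrite -expRD -mulrDr ab mulr0 expR0. Qed.

Lemma frameK p : cancel (frame p) (coframe p).
Proof.
case=> -[uv uz] ut; rewrite /coframe /frame/=; congr (_, _, _).
  by rewrite scalerA expR_cancel ?scale1r// addNr.
rewrite [br _ (_ *: _)]linearZ_LR/= [2^-1 *: _]scalerA addrK scalerA expR_cancel ?scale1r//.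
by rewrite addNr.
Qed.

Lemma coframeK p : cancel (coframe p) (frame p).
Proof.
case=> -[uv uz] ut; rewrite /coframe /frame/=; congr (_, _, _).
  by rewrite scalerA expR_cancel ?scale1r// addrN.
rewrite [br _ (_ *: _)]linearZ_LR/= !scalerA -mulrA !expR_cancel ?addrN//.
by rewrite mulr1 scale1r subrK.
Qed.

Lemma coframe_is_linear p : linear (coframe p).
Proof.
move=> a [[xv xz] xt] [[yv yz] yt]; rewrite /coframe/=; congr (_, _, _).
  by rewrite scalerDr !scalerA [_ * a]mulrC -scalerA.
rewrite [br _ (_ + _)]linearPr/= [2^-1 *: (_ + _)]scalerDr opprD addrACA scalerDr.
rewrite [2^-1 *: _]scalerA [2^-1 * a]mulrC -scalerA -scalerBr.
by congr (_ + _); rewrite !scalerA [a * _]mulrC.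
Qed.
HB.instance Definition _ p :=
  GRing.isLinear.Build R S S _ (coframe p) (coframe_is_linear p).

Lemma continuous_v : continuous (fun q : S => q.1.1).
Proof. by move=> q; apply: continuous_comp; apply: cvg_fst. Qed.

Lemma continuous_z : continuous (fun q : S => q.1.2).
Proof. by move=> q; apply: continuous_comp; [apply: cvg_fst|apply: cvg_snd]. Qed.

Lemma continuous_t : continuous (fun q : S => q.2).
Proof. by move=> q; apply: cvg_snd. Qed.

Lemma is_diff_v p : is_diff p (fun q : S => q.1.1) (fun v => v.1.1).
Proof.
have c := continuous_v.
rewrite -[fun q : S => q.1.1]/
  ((fst \o fst : {linear S -> 'rV[R]_n}) : S -> 'rV[R]_n) in c *.
by apply: DiffDef; [exact: linear_differentiable|rewrite diff_lin].
Qed.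

Lemma is_diff_z p : is_diff p (fun q : S => q.1.2) (fun v => v.1.2).
Proof.
have c := continuous_z.
rewrite -[fun q : S => q.1.2]/
  ((snd \o fst : {linear S -> 'rV[R]_m}) : S -> 'rV[R]_m) in c *.
by apply: DiffDef; [exact: linear_differentiable|rewrite diff_lin].
Qed.

Lemma is_diff_t p : is_diff p (fun q : S => q.2) (fun v => v.2).
Proof.
have c := continuous_t.
rewrite -[fun q : S => q.2]/((snd : {linear S -> R}) : S -> R) in c *.
by apply: DiffDef; [exact: linear_differentiable|rewrite diff_lin].
Qed.

Lemma smooth_v i : smooth (fun q : S => q.1.1 0 i).
Proof.
rewrite -[X in smooth X]/((rv_coord i \o (fst \o fst) : {linear S -> R}) : S -> R).
apply: smooth_linear_form => q.
by apply: continuous_comp; [exact: continuous_v|exact: rv_coord_continuous].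
Qed.

Lemma smooth_t : smooth (fun q : S => q.2).
Proof.
rewrite -[X in smooth X]/((snd : {linear S -> R}) : S -> R).
exact: (smooth_linear_form continuous_t).
Qed.

Lemma smooth_comp_v (F : S -> S) i : smooth F -> smooth (fun q => (F q).1.1 0 i).
Proof.
apply: (smooth_linear (l := (rv_coord i \o (fst \o fst) : {linear S -> R}))) => q.
by apply: continuous_comp; [exact: continuous_v|exact: rv_coord_continuous].
Qed.

Lemma smooth_comp_z (F : S -> S) i : smooth F -> smooth (fun q => (F q).1.2 0 i).
Proof.
apply: (smooth_linear (l := (rv_coord i \o (snd \o fst) : {linear S -> R}))) => q.
by apply: continuous_comp; [exact: continuous_z|exact: rv_coord_continuous].
Qed.

Lemma smooth_comp_t (F : S -> S) : smooth F -> smooth (fun q => (F q).2).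
Proof. exact: (smooth_linear (l := (snd : {linear S -> R}))) continuous_t. Qed.

Lemma smooth_exp_t (c : R) : smooth (fun q : S => expR (q.2 * c)).
Proof. by apply/smooth_expR/smoothM; [exact: smooth_t|exact: smooth_cst]. Qed.

(** The weights of [frame] and [coframe] are all kept in this shape, even for [c = 1], so that one
    derivative rule serves them. *)
Lemma is_diff_exp_t (c : R) p :
  is_diff p (fun q : S => expR (q.2 * c)) (fun v => v.2 * c * expR (p.2 * c)).
Proof.
apply: DiffDef; first exact/smooth_differentiable/smooth_exp_t.
have dt : is_diff p (fun q : S => c *: q.2) (fun v => c *: v.2).
  exact: (@is_diffZ _ _ _ _ _ c p (is_diff_t p)).
have -> : (fun q : S => expR (q.2 * c)) = expR \o (fun q : S => c *: q.2).
  by apply/funext => q /=; rewrite mulrC.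
rewrite diff_comp; last 2 first.
- exact: (@ex_diff _ _ _ _ _ _ _ dt).
- exact/derivable1_diffP/derivable_expR.
apply/funext => v /=; rewrite diff_val diff1E; last exact/derivable1_diffP/derivable_expR.
by rewrite derive1E derive_val [p.2 * c]mulrC [v.2 * c]mulrC.
Qed.

End Frame.

Lemma is_diffE (R : realType) (V W : normedModType R) (f df : V -> W) (x v : V) :
  is_diff x f df -> 'd f x v = df v.
Proof. by move=> d; rewrite (@diff_val _ _ _ _ _ _ _ d). Qed.

(** * The inner product on s and its derivative *)

Section InnerProduct.
Context {R : realType} {n m : nat}.
Local Notation S := (DR R n m).
Implicit Types (p q X Y u v w : S).

Lemma sinnerC u w : sinner u w = sinner w u.
Proof. by rewrite /sinner dotvC [dotv u.1.2 _]dotvC [u.2 * _]mulrC. Qed.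

Lemma sinnerDl u v w : sinner (u + v) w = sinner u w + sinner v w.
Proof. by rewrite /sinner/= !linearDl/= [X in X + _ = _]addrACA; exact: addrACA. Qed.

Lemma sinnerNl u w : sinner (- u) w = - sinner u w.
Proof. by rewrite /sinner/= !linearNl/= !opprD. Qed.

Lemma sinner0l w : sinner 0 w = 0.
Proof. by rewrite -(subrr w) sinnerDl sinnerNl subrr. Qed.

Lemma is_diff_sinner (V : normedModType R) (F dF G dG : V -> S) (p : V) :
  is_diff p F dF -> is_diff p G dG ->
  is_diff p (fun q : V => sinner (F q) (G q))
            (fun v : V => sinner (dF v) (G p) + sinner (F p) (dG v)).
Proof.
move=> dFp dGp.
have vF := is_diff_comp dFp (is_diff_v (F p)).
have zF := is_diff_comp dFp (is_diff_z (F p)).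
have tF := is_diff_comp dFp (is_diff_t (F p)).
have vG := is_diff_comp dGp (is_diff_v (G p)).
have zG := is_diff_comp dGp (is_diff_z (G p)).
have tG := is_diff_comp dGp (is_diff_t (G p)).
have dv := is_diff_bilinear (rV_bilinear_continuous (B := @dotv R n)) vF vG.
have dz := is_diff_bilinear (rV_bilinear_continuous (B := @dotv R m)) zF zG.
have dt := is_diffM tF tG.
apply: (is_diff_eq (is_diffD (is_diffD dv dz) dt)).
apply/funext => v; rewrite /sinner.
rewrite -[LHS]/((dotv (dF v).1.1 (G p).1.1 + dotv (F p).1.1 (dG v).1.1) +
   (dotv (dF v).1.2 (G p).1.2 + dotv (F p).1.2 (dG v).1.2) +
   ((F p).2 * (dG v).2 + (G p).2 * (dF v).2)).
by rewrite [(G p).2 * _]mulrC [(F p).2 * _ + _]addrC [X in X + _ = _]addrACA;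
  exact: addrACA.
Qed.

End InnerProduct.

(** * Derivatives of the frame, and the conformal equation in the frame *)

Section FrameCalculus.
Context {R : realType} {n m : nat}.
Variable br : {bilinear 'rV[R]_n -> 'rV[R]_n -> 'rV[R]_m}.
Local Notation S := (DR R n m).
Local Notation frame := (frame br).
Local Notation coframe := (coframe br).
Implicit Types (p q X Y u v w : S).

Let br0r a : br a 0 = 0. Proof. exact: raddf0. Qed.
Let br0l a : br 0 a = 0. Proof. exact: (raddf0 (applyr br a)). Qed.

Definition dframe p v w : S :=
  ((v.2 * 2^-1 * expR (p.2 * 2^-1)) *: w.1.1,
   (v.2 * 1 * expR (p.2 * 1)) *: w.1.2 +
   ((2^-1 * (v.2 * 2^-1 * expR (p.2 * 2^-1))) *: br p.1.1 w.1.1 +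
    (2^-1 * expR (p.2 * 2^-1)) *: br v.1.1 w.1.1),
   0).

Definition dcoframe p v X : S :=
  ((v.2 * - 2^-1 * expR (p.2 * - 2^-1)) *: X.1.1,
   (v.2 * - 1 * expR (p.2 * - 1)) *: (X.1.2 - 2^-1 *: br p.1.1 X.1.1) -
   expR (p.2 * - 1) *: (2^-1 *: br v.1.1 X.1.1),
   0).

Lemma is_diff_frame p w : is_diff p (fun q => frame q w) (fun v => dframe p v w).
Proof.
have d1 := is_diff_scale (is_diff_exp_t 2^-1 p) (is_diff_cst w.1.1 p).
have d2 := is_diff_scale (is_diff_exp_t 1 p) (is_diff_cst w.1.2 p).
have db := is_diff_bilinear (rV_bilinear_continuous (B := br))
  (is_diff_v p) (is_diff_cst w.1.1 p).
have d3 := is_diff_scale (is_diffZ 2^-1 (is_diff_exp_t 2^-1 p)) db.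
have dw := is_diff_cst w.2 p.
apply: (is_diff_eq (is_diff_pair (is_diff_pair d1 (is_diffD d2 d3)) dw)).
apply/funext => v; rewrite /dframe; congr (_, _, _).
  by rewrite scaler0 addr0.
rewrite -[LHS]/((v.2 * 1 * expR (p.2 * 1)) *: w.1.2 + expR (p.2 * 1) *: 0 +
  ((2^-1 * (v.2 * 2^-1 * expR (p.2 * 2^-1))) *: br p.1.1 w.1.1 +
   (2^-1 * expR (p.2 * 2^-1)) *: (br v.1.1 w.1.1 + br p.1.1 0))).
by rewrite scaler0 addr0 br0r addr0.
Qed.

Lemma is_diff_coframe (F dF : S -> S) p : is_diff p F dF ->
  is_diff p (fun q => coframe q (F q))
            (fun v => dcoframe p v (F p) + coframe p (dF v)).
Proof.
move=> dFp.
have vF := is_diff_comp dFp (is_diff_v (F p)).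
have zF := is_diff_comp dFp (is_diff_z (F p)).
have tF := is_diff_comp dFp (is_diff_t (F p)).
have d1 := is_diff_scale (is_diff_exp_t (- 2^-1) p) vF.
have db := is_diff_bilinear (rV_bilinear_continuous (B := br)) (is_diff_v p) vF.
have d2 := is_diff_scale (is_diff_exp_t (- 1) p) (is_diffB zF (is_diffZ 2^-1 db)).
apply: (is_diff_eq (is_diff_pair (is_diff_pair d1 d2) tF)).
apply/funext => v; rewrite /dcoframe/coframe; congr (_, _, _) => /=; last by rewrite add0r.
rewrite -[RHS]addrA; congr (_ + _).
rewrite -[X in _ *: X]/
  ((dF v).1.2 - 2^-1 *: (br v.1.1 (F p).1.1 + br p.1.1 (dF v).1.1)).
by rewrite [2^-1 *: _]scalerDr opprD addrCA scalerDr scalerN.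
Qed.

Lemma is_diff_coframe_fixed p X : is_diff X (coframe p) (coframe p).
Proof.
have d1 := is_diff_comp (is_diff_v X) (is_diff_scaler (expR (p.2 * - 2^-1)) X.1.1).
have db := is_diff_bilinear (rV_bilinear_continuous (B := br))
  (is_diff_cst p.1.1 X) (is_diff_v X).
have d2 := is_diffZ (expR (p.2 * -1)) (is_diffB (is_diff_z X) (is_diffZ 2^-1 db)).
apply: (is_diff_eq (is_diff_pair (is_diff_pair d1 d2) (is_diff_t X))).
apply/funext => v; rewrite /coframe; congr (_, _, _).
by rewrite -[LHS]/
  (expR (p.2 * - 1) *: (v.1.2 - 2^-1 *: (br 0 X.1.1 + br p.1.1 v.1.1))) br0l add0r.
Qed.

(** With [p] fixed, the exponential weights are constants and [br] is linear in its second argument,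
    so left translation is affine in these coordinates; its differential, which defines the metric,
    is then [coframe p]. *)
Lemma DRmul_inv_affine p : DRmul br (DRinv p) = cst (DRinv p) + coframe p.
Proof.
apply/funext => q; rewrite -[RHS]/(DRinv p + coframe p q).
case: p q => [[V Z] t] [[V' Z'] t']; rewrite /DRmul /DRinv /coframe/=; congr (_, _, _).
  by rewrite mulrN -mulNr.
rewrite [br (- _) _]linearNl [br (_ *: _) _]linearZl_LR/= mulrN1 -addrA; congr (_ + _).
rewrite scalerBr; congr (_ + _).
rewrite scalerN scalerA; congr (- _); rewrite scalerA; congr (_ *: _).
rewrite -mulrA -expRD mulrC; congr (expR _ * _); by field.
Qed.

Lemma DRmetricE p X Y : DRmetric br p X Y = sinner (coframe p X) (coframe p Y).
Proof.
have d := is_diffD (is_diff_cst (DRinv p) p) (is_diff_coframe_fixed p p).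
have dE Z : 'd (cst (DRinv p) + coframe p) p Z = coframe p Z.
  exact: etrans (is_diffE Z d) (add0r (coframe p Z)).
by rewrite /DRmetric DRmul_inv_affine (dE X) (dE Y).
Qed.

(** Left invariance: all the weights cancel and the coefficients no longer depend on [p].
    Antisymmetrising in [u] and [w] gives minus the bracket, which is the Maurer-Cartan equation. *)
Lemma dcoframe_frame p u w : dcoframe p (frame p u) (frame p w) =
  (- (2^-1 * u.2) *: w.1.1, - (u.2 *: w.1.2) - 2^-1 *: br u.1.1 w.1.1, 0).
Proof.
rewrite /dcoframe /=; congr (_, _, _).
  by rewrite scalerA -mulrA expR_cancel ?addNr// mulr1 mulrN mulrC.
rewrite [br _ (_ *: _)]linearZ_LR/= [2^-1 *: _]scalerA addrK scalerA -mulrA.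
rewrite expR_cancel ?addNr//.
rewrite mulr1 mulrN1 scaleNr; congr (_ - _).
rewrite [br (_ *: _) _]linearZl_LR [br _ (_ *: _)]linearZ_LR/= !scalerA; congr (_ *: _).
(* The two weights 1/2 of the arguments in v compensate the weight -1 of the z component. *)
have e : expR (p.2 * - 1) * (expR (p.2 * 2^-1) * expR (p.2 * 2^-1)) = 1.
  by rewrite -!expRD -[RHS]expR0; congr expR; field.
by rewrite -[RHS]mulr1 -[X in _ = _ * X]e; ring.
Qed.

(** This is the metric product of [xi] with the left-invariant field of value [u] at the identity;
    these functions are the unknowns of the linear system. *)
Definition frame_comp (xi : S -> S) u : S -> R :=
  fun q => sinner (coframe q (xi q)) u.

Lemma smooth_frame_comp xi u : smooth xi -> smooth (frame_comp xi u).
Proof.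
move=> sxi.
have bE (a b : 'rV[R]_n) (c : 'rV[R]_m) : dotv (br a b) c = \sum_i \sum_j
    (a 0 i * b 0 j) * dotv (br (delta_mx 0 i) (delta_mx 0 j)) c.
  rewrite {1}(row_sum_delta a) linear_sumlz linear_sumlz; apply: eq_bigr => i _.
  rewrite {1}(row_sum_delta b) linear_sumr linear_sumlz; apply: eq_bigr => j _.
  by rewrite linearZl_LR linearZ_LR/= !linearZl_LR/=.
have -> : frame_comp xi u = (fun q =>
    expR (q.2 * - 2^-1) * (\sum_i (xi q).1.1 0 i * u.1.1 0 i) +
    expR (q.2 * - 1) * ((\sum_i (xi q).1.2 0 i * u.1.2 0 i) + - 2^-1 *
      \sum_i \sum_j (q.1.1 0 i * (xi q).1.1 0 j) *
         dotv (br (delta_mx 0 i) (delta_mx 0 j)) u.1.2) + (xi q).2 * u.2).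
  apply/funext => q; rewrite /frame_comp /sinner /coframe/=.
  by rewrite !linearZl_LR/= linearBl/= linearZl_LR/= bE !dotvE mulNr.
have sc (c : R) : smooth (fun _ : S => c) by exact: smooth_cst.
apply: smoothD; last by apply: smoothM => //; exact: smooth_comp_t.
apply: smoothD; apply: smoothM; try exact: smooth_exp_t.
  by apply: smooth_sum => i; apply: smoothM => //; exact: smooth_comp_v.
apply: smoothD.
  by apply: smooth_sum => i; apply: smoothM => //; exact: smooth_comp_z.
apply: smoothM => //; apply: smooth_sum => i; apply: smooth_sum => j.
apply: smoothM => //; apply: smoothM; [exact: smooth_v|exact: smooth_comp_v].
Qed.

(** The field is a sum of smooth functions times constant vectors, once the base point inside [br]
    is expanded over the standard basis. *)
Lemma smooth_field_frame u : smooth_field (fun q => frame q u).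
Proof.
have -> : (fun q => frame q u) = (fun q =>
    expR (q.2 * 2^-1) *: (u.1.1, 0, 0) + expR (q.2 * 1) *: (0, u.1.2, 0) +
    \sum_i (2^-1 * expR (q.2 * 2^-1) * q.1.1 0 i) *:
       (0, br (delta_mx 0 i) u.1.1, 0) + (0, 0, u.2)).
  apply/funext => q; rewrite /frame {1}(row_sum_delta q.1.1) linear_sumlz scaler_sumr.
  have -> : \sum_i (2^-1 * expR (q.2 * 2^-1) * q.1.1 0 i) *:
       ((0, br (delta_mx 0 i) u.1.1, 0) : S) =
     (0, \sum_i (2^-1 * expR (q.2 * 2^-1)) *: br (q.1.1 0 i *: delta_mx 0 i) u.1.1, 0).
    elim/big_rec2: _ => // i y1 y2 _ ->; rewrite [br (_ *: _) _]linearZl_LR/= scalerA.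
    set k := _ * q.1.1 0 i; set b := br _ _.
    by rewrite -[LHS]/(k *: 0 + 0, k *: b + y1, k * 0 + 0) scaler0 mulr0 !addr0.
  set a := expR _; set b := expR _; set c := \sum_i _.
  rewrite -[RHS]/(a *: u.1.1 + b *: 0 + 0 + 0, a *: 0 + b *: u.1.2 + c + 0,
                  a * 0 + b * 0 + 0 + u.2).
  by rewrite !scaler0 !mulr0 !addr0 !add0r.
have se := @smooth_exp_t R n m.
apply: smooth_fieldD; last exact: smooth_field_cst.
apply: smooth_fieldD; first by apply: smooth_fieldD; exact: smooth_fieldZ.
apply: smooth_field_sum => i; apply: smooth_fieldZ; apply: smoothM; last exact: smooth_v.
by apply: smoothM => //; exact: smooth_cst.
Qed.

Hypothesis br_anti : forall a b, br a b = - br b a.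

(** The factor 1/2 of the group law yields half of [br] from each differential, and antisymmetry
    adds the halves up; the weights 1/2 and 1 yield the action of ad A. *)
Lemma frame_bracket p u w :
  'd (fun q => frame q w) p (frame p u) - 'd (fun q => frame q u) p (frame p w) =
  frame p (lie br u w).
Proof.
have dw := is_diff_frame p w; have du := is_diff_frame p u.
apply: etrans (congr2 (fun x y : S => x - y)
  (is_diffE (frame p u) dw) (is_diffE (frame p w) du)) _.
rewrite /dframe /frame /lie/=; congr (_, _, _) => /=; last by rewrite subrr.
  apply/rowP => i; rewrite !mxE; ring.
rewrite ![br (_ *: _) _]linearZl_LR/= ![br _ (_ *: _)]linearZ_LR/= [br _ (_ - _)]linearBr/=.
rewrite ![br _ (_ *: _)]linearZ_LR/= [br w.1.1 u.1.1]br_anti.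
have e : expR (p.2 * 1) = expR (p.2 * 2^-1) * expR (p.2 * 2^-1).
  by rewrite -expRD; congr expR; by field.
by apply/rowP => i; rewrite !mxE e; field.
Qed.

Lemma lie_derive_frame_commutator u w f p : smooth f ->
  lie_derive (fun q => frame q u) (lie_derive (fun q => frame q w) f) p -
  lie_derive (fun q => frame q w) (lie_derive (fun q => frame q u) f) p =
  lie_derive (fun q => frame q (lie br u w)) f p.
Proof.
move=> sf; rewrite lie_derive_commutator//; try exact: smooth_field_frame.
by rewrite frame_bracket.
Qed.

(** The differential of [xi] enters both the derivatives of the components and the conformal
    equation. Eliminating it leaves differences of [dcoframe] terms, which are brackets. *)
Lemma conformal_frame_eq xi rho u w p :
  conformal_with_potential (DRmetric br) xi rho ->
  lie_derive (fun q => frame q u) (frame_comp xi w) p +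
  lie_derive (fun q => frame q w) (frame_comp xi u) p =
  sinner (lie br (coframe p (xi p)) u) w + sinner (lie br (coframe p (xi p)) w) u
  + 2 * rho p * sinner u w.
Proof.
move=> [sxi [_ conf]].
have dxi := differentiableP (smooth_differentiable p sxi).
have cE X v : 'd (fun q => sinner (coframe q (xi q)) X) p v =
    sinner (dcoframe p v (xi p)) X + sinner (coframe p ('d xi p v)) X.
  apply: etrans (is_diffE v (is_diff_sinner (is_diff_coframe dxi) (is_diff_cst X p))) _.
  by rewrite sinnerDl [X in _ + X]sinnerC sinner0l addr0.
(* [lie_deriv_metric] works with constant coordinate fields, so the frame vectors are frozen at [p]
   and only the coframe is differentiated. *)
have gE : 'd (fun q => DRmetric br q (frame p u) (frame p w)) p (xi p) =
    sinner (dcoframe p (xi p) (frame p u)) w + sinner (dcoframe p (xi p) (frame p w)) u.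
  have -> : (fun q => DRmetric br q (frame p u) (frame p w)) =
    (fun q => sinner (coframe q (cst (frame p u) q)) (coframe q (cst (frame p w) q))).
    by apply/funext => q; rewrite DRmetricE.
  apply: etrans (is_diffE (xi p) (is_diff_sinner
    (is_diff_coframe (is_diff_cst (frame p u) p))
    (is_diff_coframe (is_diff_cst (frame p w) p)))) _.
  have c0 : coframe p 0 = 0 by exact: raddf0.
  by rewrite !c0 !addr0 !frameK; congr (_ + _); exact: sinnerC.
have E : sinner (dcoframe p (xi p) (frame p u)) w +
    sinner (dcoframe p (xi p) (frame p w)) u +
    sinner (coframe p ('d xi p (frame p u))) w +
    sinner (coframe p ('d xi p (frame p w))) u = 2 * rho p * sinner u w.
  move: (conf p (frame p u) (frame p w));
  rewrite /lie_deriv_metric gE !DRmetricE !frameK => <-.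
  by congr (_ + _); exact: sinnerC.
rewrite /lie_derive /frame_comp cE cE -E -[xi p](coframeK br p) frameK.
set a := coframe p (xi p).
(* The Maurer-Cartan equation: exchanging the two arguments costs a bracket. *)
have lE z : dcoframe p (frame p z) (frame p a) =
    dcoframe p (frame p a) (frame p z) + lie br a z.
  rewrite !dcoframe_frame /lie.
  set L := RHS; rewrite -[L]/(_ *: z.1.1 + _ *: _, _ - _ *: _ + (_ - _ + _), 0 + 0) {}/L.
  congr (_, _, _); last by rewrite addr0.
    by apply/rowP => i; rewrite !mxE; field.
  by rewrite [br z.1.1 a.1.1]br_anti; apply/rowP => i; rewrite !mxE; field.
rewrite !lE !sinnerDl.
set A := sinner (dcoframe _ _ _) w; set B := sinner (dcoframe _ _ _) u.
set C := sinner (coframe _ _) w; set D := sinner (coframe _ _) u.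
set G := sinner (lie br a u) w; set H := sinner (lie br a w) u.
move: A B C D G H => A B C D G H; lra.
Qed.

End FrameCalculus.

(** * Algebraic elimination in the four-dimensional system *)

Section Prolongation.
Context {R : realType} {T : Type} (sm : (T -> R) -> Prop).
Implicit Types (D : (T -> R) -> T -> R) (f g : T -> R).

(** The class [sm] stands for smooth functions, so that the elimination is pure algebra with linear
    operators and their commutators. *)
Definition linear_on D := (forall f, sm f -> sm (D f)) /\
  forall (k l : R) f g, sm f -> sm g ->
    D (fun q => k * f q + l * g q) = (fun q => k * D f q + l * D g q).

(* The combination of the equations and their derivatives was found by solving
   a linear system in the enveloping algebra of the frame; normal order is
   A, V, W, Z. *)
Lemma conformal_CH2_potential0 (A V W Z : (T -> R) -> T -> R)
    (a v w z rho : T -> R) (p : T) :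
  linear_on A -> linear_on V -> linear_on W -> linear_on Z ->
  sm a -> sm v -> sm w -> sm z -> sm rho ->
  (forall f q, sm f -> A (V f) q - V (A f) q = 2^-1 * V f q) ->
  (forall f q, sm f -> A (W f) q - W (A f) q = 2^-1 * W f q) ->
  (forall f q, sm f -> A (Z f) q - Z (A f) q = 1 * Z f q) ->
  (forall f q, sm f -> V (W f) q - W (V f) q = 1 * Z f q) ->
  (forall f q, sm f -> V (Z f) q - Z (V f) q = 0) ->
  (forall f q, sm f -> W (Z f) q - Z (W f) q = 0) ->
  (forall q, A a q = rho q) ->
  (forall q, V v q = rho q + 2^-1 * a q) ->
  (forall q, W w q = rho q + 2^-1 * a q) ->
  (forall q, Z z q = rho q + a q) ->
  (forall q, A w q + W a q = - (2^-1 * w q)) ->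
  (forall q, A z q + Z a q = - z q) ->
  (forall q, V w q + W v q = 0) ->
  (forall q, V z q + Z v q = - w q) ->
  (forall q, W z q + Z w q = v q) ->
  rho p = 0.
Proof.
move=> [sA lA] [sV lV] [sW lW] [sZ lZ] sa sv sw sz srho.
move=> cAV cAW cAZ cVW cVZ cWZ eAA eVV eWW eZZ eAW eAZ eVW eVZ eWZ.
(* Every relation is turned into an equality of functions in this shape, so that it can be
   substituted under further operators and then distributed by linearity. *)
pose comb (k l : R) f g : T -> R := fun q => k * f q + l * g q.
have VA f : sm f -> V (A f) = comb 1 (- 2^-1) (A (V f)) (V f).
  by move=> sf; apply/funext => q; rewrite /comb; have := cAV f q sf; lra.
have WA f : sm f -> W (A f) = comb 1 (- 2^-1) (A (W f)) (W f).
  by move=> sf; apply/funext => q; rewrite /comb; have := cAW f q sf; lra.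
have ZA f : sm f -> Z (A f) = comb 1 (- 1) (A (Z f)) (Z f).
  by move=> sf; apply/funext => q; rewrite /comb; have := cAZ f q sf; lra.
have WV f : sm f -> W (V f) = comb 1 (- 1) (V (W f)) (Z f).
  by move=> sf; apply/funext => q; rewrite /comb; have := cVW f q sf; lra.
have ZV f : sm f -> Z (V f) = V (Z f).
  by move=> sf; apply/funext => q; have := cVZ f q sf; lra.
have ZW f : sm f -> Z (W f) = W (Z f).
  by move=> sf; apply/funext => q; have := cWZ f q sf; lra.
have fWw : W w = comb 1 2^-1 rho a.
  by apply/funext => q; rewrite /comb eWW; lra.
have fZz : Z z = comb 1 1 rho a by apply/funext => q; rewrite /comb eZZ; lra.
have fAw : A w = comb (- 1) (- 2^-1) (W a) w.
  by apply/funext => q; rewrite /comb; have := eAW q; lra.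
have fAz : A z = comb (- 1) (- 1) (Z a) z.
  by apply/funext => q; rewrite /comb; have := eAZ q; lra.
(* The zero multiple of [v] only keeps the shape [comb]. *)
have fVw : V w = comb (- 1) 0 (W v) v.
  by apply/funext => q; rewrite /comb; have := eVW q; lra.
have fVz : V z = comb (- 1) (- 1) (Z v) w.
  by apply/funext => q; rewrite /comb; have := eVZ q; lra.
have fWz : W z = comb (- 1) 1 (Z w) v.
  by apply/funext => q; rewrite /comb; have := eWZ q; lra.
have AW : A (W w) p = comb 1 2^-1 (A rho) (A a) p by rewrite fWw lA.
have AZ : A (Z z) p = comb 1 1 (A rho) (A a) p by rewrite fZz lA.
have VW : V (W z) p = comb (- 1) 1 (V (Z w)) (V v) p by rewrite fWz lV; auto.
have WVz : W (V z) p = comb (- 1) (- 1) (W (Z v)) (W w) p.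
  by rewrite fVz lW; auto.
have ZVw : Z (V w) p = comb (- 1) 0 (Z (W v)) (Z v) p by rewrite fVw lZ; auto.
(* Third-order words are evaluated in two ways: here by substituting the solved equations, and in
   the primed facts by the commutators. *)
have AWV : A (W (V z)) p = comb (- 1) (- 1) (A (W (Z v))) (A (W w)) p.
  by rewrite fVz lW ?lA; auto.
have AZV : A (Z (V w)) p = comb (- 1) 0 (A (Z (W v))) (A (Z v)) p.
  by rewrite fVw lZ ?lA; auto.
have VWA : V (W (A z)) p = comb (- 1) (- 1) (V (W (Z a))) (V (W z)) p.
  by rewrite fAz lW ?lV; auto.
have VZA : V (Z (A w)) p = comb (- 1) (- 2^-1) (V (Z (W a))) (V (Z w)) p.
  by rewrite fAw lZ ?lV; auto.
have VWA' : V (W (A z)) p = A (V (W z)) p - V (W z) p.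
  by rewrite WA// lV; auto; rewrite VA; auto; rewrite /comb; lra.
have VZA' : V (Z (A w)) p = A (V (Z w)) p - 3 / 2 * V (Z w) p.
  by rewrite ZA// lV; auto; rewrite VA; auto; rewrite /comb; lra.
have AWV' : A (W (V z)) p = A (V (W z)) p - A (Z z) p.
  by rewrite WV// lA; auto; rewrite /comb; lra.
have WVz' : W (V z) p = V (W z) p - Z z p by rewrite WV//= /comb; lra.
(* The third-order relations, with [AW], [AZ] and [eAA], force [V (Z w) p] to be minus half of
   [rho p]; the second-order ones force it to be plus half of [rho p]. *)
have := (eAA p, eVV p, eWW p, eZZ p); move=> [[[]]].
move: AW AZ VW WVz ZVw AWV AZV VWA VZA VWA' VZA' AWV' WVz'.
rewrite (ZW a)// (ZV w)// (ZW v)// /comb.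
lra.
Qed.

End Prolongation.

(** * Identities for the maps J, and the complex hyperbolic subalgebra *)

Section Heisenberg.
Context {R : realType} {n m : nat}.
Variable br : {bilinear 'rV[R]_n -> 'rV[R]_n -> 'rV[R]_m}.
Hypothesis br_anti : forall a b, br a b = - br b a.
Hypothesis Jsq : forall z, Jmap br z *m Jmap br z = - (dotv z z) *: 1%:M.

Lemma dotv_Jmap z u w : dotv (u *m Jmap br z) w = dotv z (br u w).
Proof.
rewrite dotvE (dotvC z).
rewrite {2}(row_sum_delta u) {2}(row_sum_delta w).
rewrite linear_sumr linear_sumlz; apply: eq_bigr => j _.
rewrite linear_sumlz linear_sumlz mxE mulr_suml; apply: eq_bigr => i _.
rewrite linearZ_LR linearZl_LR/= !linearZl_LR/= mxE (dotvC z).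
by rewrite -[LHS]/(u 0 i * (_ * _)) mulrA; exact: mulrC.
Qed.

Lemma dotv_Jmap_skew z u w : dotv u (w *m Jmap br z) = - dotv (u *m Jmap br z) w.
Proof. by rewrite dotvC !dotv_Jmap br_anti linearNr. Qed.

Lemma dotv_JmapJ z u w :
  dotv (u *m Jmap br z) (w *m Jmap br z) = dotv z z * dotv u w.
Proof.
rewrite dotv_Jmap_skew -mulmxA Jsq -scalemxAr mulmx1 linearZl_LR.
by rewrite -[X in - X]/(- dotv z z * dotv u w) mulNr opprK.
Qed.

Lemma JmapD z z' : Jmap br (z + z') = Jmap br z + Jmap br z'.
Proof. by apply/matrixP => i j; rewrite !mxE linearDl. Qed.

Lemma dotv_self_Jmap z u : dotv u (u *m Jmap br z) = 0.
Proof.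
have := dotv_Jmap_skew z u u; rewrite [X in _ = - X]dotvC.
set c := dotv _ _; move: c => c; lra.
Qed.

(** Polarisation of [dotv_JmapJ] in [z]. *)
Lemma dotv_JmapJ2 z z' u :
  dotv (u *m Jmap br z) (u *m Jmap br z') = dotv z z' * dotv u u.
Proof.
have := dotv_JmapJ (z + z') u u.
rewrite JmapD mulmxDr !linearDl/= !linearDr/= !dotv_JmapJ.
rewrite (dotvC (u *m Jmap br z')) (dotvC z').
set c := dotv (_ *m _) _; set d := dotv z z'; set e := dotv u u.
set f := dotv z z; set g := dotv z' z'.
move: c d e f g => c d e f g; lra.
Qed.

(** Pairing with any [x] in z turns the bracket into the product of [J_x u] and [J_z u], given by
    [dotv_JmapJ2]; nondegeneracy concludes. *)
Lemma br_Jmap z u : br u (u *m Jmap br z) = dotv u u *: z.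
Proof.
have nondeg (y : 'rV[R]_m) : (forall x, dotv x y = 0) -> y = 0.
  move=> y0; apply/rowP => i; rewrite [RHS]mxE -(y0 (delta_mx 0 i)) dotvE (bigD1 i)//=.
  rewrite mxE !eqxx mul1r big1 ?addr0// => j ji.
  by rewrite mxE eqxx (negbTE ji) mul0r.
apply/eqP; rewrite -subr_eq0; apply/eqP/nondeg => x.
by rewrite linearBr/= linearZr_LR/= -dotv_Jmap dotv_JmapJ2 mulrC subrr.
Qed.

Lemma frameZ (p u : DR R n m) (k : R) : frame br p (k *: u) = k *: frame br p u.
Proof.
case: u => [[uv uz] ut].
rewrite /frame -[k *: (uv, uz, ut)]/(k *: uv, k *: uz, k * ut) /=.
set a := expR _; set b := expR _.
rewrite -[RHS]/(k *: (a *: uv), k *: (b *: uz + (2^-1 * a) *: br p.1.1 uv), k * ut).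
rewrite [br _ (_ *: _)]linearZr_LR/=; congr (_, _, _).
  by rewrite !scalerA mulrC.
by rewrite scalerDr !scalerA ![k * _]mulrC.
Qed.

Lemma frame_linear_on (u : DR R n m) :
  linear_on (@smooth R _ _) (lie_derive (fun q => frame br q u)).
Proof.
split=> [f|k l f g] sf; first by apply: smooth_lie_derive => //; exact: smooth_field_frame.
move=> sg; have sc (c : R) h : smooth h -> smooth (fun q : DR R n m => c * h q).
  by move=> sh; apply: smoothM => //; exact: smooth_cst.
by rewrite lie_deriveD ?lie_deriveZ//; exact: sc.
Qed.

Lemma lie_derive_frameZ (u w e : DR R n m) (k : R) f p :
  lie br u w = k *: e -> smooth f ->
  lie_derive (fun q => frame br q u) (lie_derive (fun q => frame br q w) f) p -
  lie_derive (fun q => frame br q w) (lie_derive (fun q => frame br q u) f) p =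
  k * lie_derive (fun q => frame br q e) f p.
Proof.
move=> E sf; rewrite lie_derive_frame_commutator// E /lie_derive frameZ.
exact: linearZ_LR.
Qed.

(** It remains to check that A, V, J_Z V and Z are orthonormal, satisfy the required brackets, and
    that the frame equations among them involve no other component of [xi]. *)
Lemma conformal_potential0 xi rho (Vu : 'rV[R]_n) (Zu : 'rV[R]_m) p :
  dotv Vu Vu = 1 -> dotv Zu Zu = 1 ->
  conformal_with_potential (DRmetric br) xi rho -> rho p = 0.
Proof.
move=> V1 Z1 conf; have [sxi [srho _]] := conf.
pose Wu := Vu *m Jmap br Zu.
have W1 : dotv Wu Wu = 1 by rewrite dotv_JmapJ V1 Z1 mulr1.
have VW0 : dotv Vu Wu = 0 by exact: dotv_self_Jmap.
have WV0 : dotv Wu Vu = 0 by rewrite dotvC.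
have brVW : br Vu Wu = Zu by rewrite br_Jmap V1 scale1r.
(* The system closes here: for arbitrary [u] in v, brackets with [Vu] and [Wu] paired with [Zu] see
   only the components of [u] along [Wu] and [Vu]. *)
have brVV (u : 'rV[R]_n) : dotv (br u Vu) Zu = - dotv u Wu.
  by rewrite dotvC -dotv_Jmap dotv_Jmap_skew opprK.
have brWW (u : 'rV[R]_n) : dotv (br u Wu) Zu = dotv u Vu.
  by rewrite dotvC -dotv_Jmap dotv_JmapJ Z1 mul1r.
have d0 k (u : 'rV[R]_k) : (dotv u 0 = 0) * (dotv 0 u = 0).
  by split; rewrite /dotv ?trmx0 ?mulmx0 ?mul0mx mxE.
have br0 : (forall u, br u 0 = 0) * (forall u, br 0 u = 0).
  by split=> u; [exact: raddf0|exact: (raddf0 (applyr br u))].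
pose eA : DR R n m := (0, 0, 1); pose eV : DR R n m := (Vu, 0, 0).
pose eW : DR R n m := (Wu, 0, 0); pose eZ : DR R n m := (0, Zu, 0).
pose L u := lie_derive (fun q => frame br q u).
pose c u := frame_comp br xi u.
have sL u : linear_on (@smooth R _ _) (L u) by exact: frame_linear_on.
have sc u : smooth (c u) by exact: smooth_frame_comp.
have comm u w e k f q : lie br u w = k *: e -> smooth f ->
    L u (L w f) q - L w (L u f) q = k * L e f q by exact: lie_derive_frameZ.
have eqn u w q : L u (c w) q + L w (c u) q =
    sinner (lie br (coframe br q (xi q)) u) w +
    sinner (lie br (coframe br q (xi q)) w) u + 2 * rho q * sinner u w.
  exact: conformal_frame_eq.
have cE u q : sinner (coframe br q (xi q)) u = c u q by [].
clearbody L c.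
have ip : [/\ sinner eA eA = 1, sinner eV eV = 1, sinner eW eW = 1 & sinner eZ eZ = 1].
  split; rewrite /sinner/= !d0 ?V1 ?W1 ?Z1; ring.
have orth : [/\ sinner eA eW = 0, sinner eA eZ = 0, sinner eV eW = 0,
              sinner eV eZ = 0 & sinner eW eZ = 0].
  split; rewrite /sinner/= !d0 ?VW0; ring.
have [[AA VV WW ZZ] [AW AZ VW VZ WZ]] := (ip, orth).
have lieEA x : lie br x eA = (- (2^-1 *: x.1.1), - x.1.2, 0).
  by rewrite /lie/= !scaler0 scale1r !sub0r br0 addr0 scalerN scale1r.
have lieEv x y : lie br x (y, 0, 0) = ((2^-1 * x.2) *: y, br x.1.1 y, 0).
  by rewrite /lie/= scale0r subr0 scaler0 scale0r subr0 add0r scalerA.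
have lieEZ x : lie br x eZ = (0, x.2 *: Zu, 0).
  by rewrite /lie/= !scaler0 !scale0r !subr0 br0 addr0 scaler0.
have lieA x : [/\ sinner (lie br x eA) eA = 0,
    sinner (lie br x eA) eW = - (2^-1 * sinner x eW)
    & sinner (lie br x eA) eZ = - sinner x eZ].
  by rewrite lieEA; split; rewrite /sinner/= ?dotvNl ?dotvZl !d0; ring.
have lieV x : [/\ sinner (lie br x eV) eV = 2^-1 * sinner x eA,
    sinner (lie br x eV) eW = 0
    & sinner (lie br x eV) eZ = - sinner x eW].
  by rewrite lieEv; split; rewrite /sinner/= ?dotvZl ?V1 ?VW0 ?brVV !d0; ring.
have lieW x : [/\ sinner (lie br x eW) eA = 0, sinner (lie br x eW) eV = 0,
    sinner (lie br x eW) eW = 2^-1 * sinner x eA & sinner (lie br x eW) eZ = sinner x eV].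
  by rewrite lieEv; split; rewrite /sinner/= ?dotvZl ?W1 ?WV0 ?brWW !d0; ring.
have lieZ x : [/\ sinner (lie br x eZ) eA = 0, sinner (lie br x eZ) eV = 0,
    sinner (lie br x eZ) eW = 0 & sinner (lie br x eZ) eZ = sinner x eA].
  by rewrite lieEZ; split; rewrite /sinner/= ?dotvZl ?Z1 !d0; ring.
apply: (@conformal_CH2_potential0 R _ (@smooth R _ _) (L eA) (L eV) (L eW) (L eZ)
  (c eA) (c eV) (c eW) (c eZ) rho p) => //.
- move=> f q; apply: comm; rewrite /lie/=.
  rewrite -[RHS]/(2^-1 *: Vu, 2^-1 *: 0, 2^-1 * 0).
  by rewrite !(scaler0, br0, scale1r, scale0r, subr0, addr0, add0r, oppr0, mulr0).
- move=> f q; apply: comm; rewrite /lie/=.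
  rewrite -[RHS]/(2^-1 *: Wu, 2^-1 *: 0, 2^-1 * 0).
  by rewrite !(scaler0, br0, scale1r, scale0r, subr0, addr0, add0r, oppr0, mulr0).
- move=> f q; apply: comm; rewrite /lie/= scale1r.
  by rewrite !(scaler0, br0, scale1r, scale0r, subr0, addr0, add0r, oppr0, mulr0).
- move=> f q; apply: comm; rewrite /lie/= scale1r brVW.
  by rewrite !(scaler0, br0, scale1r, scale0r, subr0, addr0, add0r, oppr0, mulr0).
(* A vanishing bracket is presented to [comm] as the zero multiple of the zero vector. *)
- move=> f q sf; rewrite (comm eV eZ 0 0 f q) ?mul0r// /lie/= scaler0.
  by rewrite !(scaler0, br0, scale1r, scale0r, subr0, addr0, add0r, oppr0, mulr0).
- move=> f q sf; rewrite (comm eW eZ 0 0 f q) ?mul0r// /lie/= scaler0.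
  by rewrite !(scaler0, br0, scale1r, scale0r, subr0, addr0, add0r, oppr0, mulr0).
- move=> q; move: (eqn eA eA q).
  by have [-> _ _] := lieA (coframe br q (xi q)); rewrite AA; lra.
- move=> q; move: (eqn eV eV q).
  by have [-> _ _] := lieV (coframe br q (xi q)); rewrite VV cE; lra.
- move=> q; move: (eqn eW eW q).
  by have [_ _ -> _] := lieW (coframe br q (xi q)); rewrite WW cE; lra.
- move=> q; move: (eqn eZ eZ q).
  by have [_ _ _ ->] := lieZ (coframe br q (xi q)); rewrite ZZ cE; lra.
- move=> q; move: (eqn eA eW q); have [_ -> _] := lieA (coframe br q (xi q)).
  by have [-> _ _ _] := lieW (coframe br q (xi q)); rewrite AW cE; lra.
- move=> q; move: (eqn eA eZ q); have [_ _ ->] := lieA (coframe br q (xi q)).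
  by have [-> _ _ _] := lieZ (coframe br q (xi q)); rewrite AZ cE; lra.
- move=> q; move: (eqn eV eW q); have [_ -> _] := lieV (coframe br q (xi q)).
  by have [_ -> _ _] := lieW (coframe br q (xi q)); rewrite VW; lra.
- move=> q; move: (eqn eV eZ q); have [_ _ ->] := lieV (coframe br q (xi q)).
  by have [_ -> _ _] := lieZ (coframe br q (xi q)); rewrite VZ cE; lra.
- move=> q; move: (eqn eW eZ q); have [_ _ _ ->] := lieW (coframe br q (xi q)).
  by have [_ _ -> _] := lieZ (coframe br q (xi q)); rewrite WZ cE; lra.
Qed.

End Heisenberg.

Theorem theorem1p1 (R : realType) (n m : nat)
  (br : 'rV[R]_n -> 'rV[R]_n -> 'rV[R]_m)
  (hn : (0 < n)%N) (hm : (0 < m)%N)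
  (hH : is_gen_heisenberg br)
  (xi : DR R n m -> DR R n m) (rho : DR R n m -> R)
  (hconf : conformal_with_potential (DRmetric br) xi rho) :
  forall p : DR R n m, rho p = 0.
Proof.
move=> p; have [brDl brDr br_anti _ Jsq] := hH.
have br_bilin : bilinear_for
    (GRing.Scale.Law.clone _ _ *:%R _) (GRing.Scale.Law.clone _ _ *:%R _) br.
  by split=> [w|u] a x y; [exact: brDl|exact: brDr].
pose brM := bilinear_isBilinear.Build R _ _ _ _ _ br br_bilin.
pose B : {bilinear 'rV[R]_n -> 'rV[R]_n -> 'rV[R]_m} := HB.pack br brM.
have unit k (i : 'I_k) : dotv (delta_mx 0 i : 'rV[R]_k) (delta_mx 0 i) = 1.
  rewrite dotvE (bigD1 i)//= !mxE !eqxx mulr1 big1 ?addr0// => j ji.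
  by rewrite !mxE eqxx (negbTE ji) mul0r.
(* Both dimensions being positive, the first standard basis vectors serve as unit vectors in v and
   z. *)
exact: (@conformal_potential0 R n m B br_anti Jsq xi rho _ _ p
          (unit n (Ordinal hn)) (unit m (Ordinal hm)) hconf).
Qed.
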